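(* Let $R$ be a Krull domain with fraction field $K$ and let $A$ be an $R$-algebra that is finitely presented and flat as an $R$-module. Let $$\mathrm{BlEx}(A)=\{\mathfrak{p}\in\operatorname{Spec}(R)\mid \mathrm{Bl}_A(\mathfrak{p})<\mathrm{Bl}_A((0))\}$$ be the set of primes $\mathfrak{p}$ such that the partition of the set of blocks of $A^K$ defined by the blocks of $A_{\mathfrak{p}}$ is strictly coarser than the trivial partition into singletons. Then $\mathrm{BlEx}(A)$ is a reduced Weil divisor in $\operatorname{Spec}(R)$, i.e. it is a closed subset which is either empty or pure of codimension one with finitely many irreducible components.
   Context: Block idempotents of a ring are its centrally-primitive idempotents (primitive idempotents of the center). Let $\{c_i\}_{i\in I}$ be the block idempotents of $A^K=K\otimes_R A$. For $\mathfrak{p}\in\operatorname{Spec}(R)$ the canonical map $A_{\mathfrak{p}}\to A^K$ is injective, and each block idempotent of $A_{\mathfrak{p}}$ is, in $A^K$, a sum $\sum_{i\in I'}c_i$ for a unique $I'\subseteq I$; the subsets $I'$ so obtained form a partition $\mathrm{Bl}_A(\mathfrak{p})$ of $I$. Partitions are ordered by $\mathscr{P}'\leq\mathscr{P}$ iff each member of $\mathscr{P}'$ is a union of members of $\mathscr{P}$. At the generic point, $\mathrm{Bl}_A((0))=\{\{i\}\mid i\in I\}$ is the trivial (finest) partition. *)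

(* Defs.v *)
From HB Require Import structures.
From mathcomp Require Import all_boot all_order all_algebra.
From mathcomp Require Import all_classical.
From mathcomp Require Import topology.

Set Implicit Arguments.
Unset Strict Implicit.
Unset Printing Implicit Defensive.

Import Order.TTheory GRing.Theory Num.Theory.
Local Open Scope classical_set_scope.
Local Open Scope ring_scope.
Local Open Scope quotient_scope.

(* Tensor products over a commutative ring.  Elements are classes of finite
   formal sums of pairs; the relation is the congruence of commutative monoids
   generated by biadditivity and R-balancedness.  No formal negatives are
   needed, because (m, n) + (- m, n) ~ (0, n) ~ 0. *)

Section TensorDef.
Variables (R : comPzRingType) (M N : lmodType R).

Inductive tens_eq : seq (M * N) -> seq (M * N) -> Prop :=
| TensRefl s : tens_eq s s
| TensSym s t : tens_eq s t -> tens_eq t s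
| TensTrans s t u : tens_eq s t -> tens_eq t u -> tens_eq s u
| TensCat s s' t t' : tens_eq s s' -> tens_eq t t' ->
    tens_eq (s ++ t) (s' ++ t')
| TensComm s t : tens_eq (s ++ t) (t ++ s)
| TensZero n : tens_eq [:: (0, n)] [::]
| TensAddl m m' n : tens_eq [:: (m + m', n)] [:: (m, n); (m', n)]
| TensAddr m n n' : tens_eq [:: (m, n + n')] [:: (m, n); (m, n')]
| TensScale r m n : tens_eq [:: (r *: m, n)] [:: (m, r *: n)].

Definition tens_rel (s t : seq (M * N)) : bool := `[< tens_eq s t >].

Fact tens_rel_refl : reflexive tens_rel.
Proof. by move=> s; apply/asboolP; exact: TensRefl. Qed.

Fact tens_rel_sym : symmetric tens_rel.
Proof. by move=> s t; apply/asboolP/asboolP; exact: TensSym. Qed.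

Fact tens_rel_trans : transitive tens_rel.
Proof. by move=> s t u /asboolP ts /asboolP su; apply/asboolP/(TensTrans ts). Qed.

Canonical tens_equiv := EquivRel tens_rel tens_rel_refl tens_rel_sym tens_rel_trans.

Definition tensor := {eq_quot tens_rel}.

HB.instance Definition _ : EqQuotient _ tens_rel tensor := EqQuotient.on tensor.
HB.instance Definition _ := Choice.on tensor.

Lemma tens_piP (s t : seq (M * N)) :
  \pi_tensor s = \pi_tensor t <-> tens_eq s t.
Proof. by split=> [/eqmodP /asboolP|/asboolP st]; last exact/eqmodP. Qed.

Lemma tens_repr (s : seq (M * N)) : tens_eq (repr (\pi_tensor s)) s.
Proof. by apply/tens_piP; rewrite reprK. Qed.

Definition tens_add (x y : tensor) : tensor := \pi_tensor (repr x ++ repr y).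
Definition tens_opp (x : tensor) : tensor :=
  \pi_tensor [seq (- p.1, p.2) | p <- repr x].

Lemma tens_addE s t : tens_add (\pi_tensor s) (\pi_tensor t) = \pi_tensor (s ++ t).
Proof. by apply/tens_piP; apply: TensCat; exact: tens_repr. Qed.

Fact tens_addA : associative tens_add.
Proof.
move=> x y z; apply/tens_piP.
apply: (TensTrans (TensCat (TensRefl _) (tens_repr _))); rewrite catA.
exact/TensSym/(TensCat (tens_repr _) (TensRefl _)).
Qed.

Fact tens_addC : commutative tens_add.
Proof. by move=> x y; apply/tens_piP; exact: TensComm. Qed.

Fact tens_add0 : left_id (\pi_tensor [::]) tens_add.
Proof.
move=> x; rewrite -[RHS]reprK; apply/tens_piP.
exact: (TensCat (tens_repr [::]) (TensRefl _)).
Qed.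

Fact tens_addN : left_inverse (\pi_tensor [::]) tens_opp tens_add.
Proof.
move=> x; apply/tens_piP.
apply: (TensTrans (TensCat (tens_repr _) (TensRefl _))).
elim: (repr x) => [|[m n] s IH] /=; first exact: TensRefl.
have H : tens_eq ((- m, n) :: [seq (- p.1, p.2) | p <- s] ++ (m, n) :: s)
   ([:: (- m, n); (m, n)] ++ ([seq (- p.1, p.2) | p <- s] ++ s)).
  rewrite -cat1s -[in X in tens_eq _ X](cat1s (- m, n)) -!catA.
  apply: TensCat; first exact: TensRefl.
  rewrite -cat1s !catA; apply: TensCat; last exact: TensRefl.
  exact: TensComm.
apply: (TensTrans H); rewrite -[[::]]/([::] ++ [::]); apply: TensCat => //.
apply: TensTrans (TensZero n); rewrite -(addNr m).
exact/TensSym/TensAddl.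
Qed.

HB.instance Definition _ :=
  GRing.isZmodule.Build tensor tens_addA tens_addC tens_add0 tens_addN.

Definition tens (m : M) (n : N) : tensor := \pi_tensor [:: (m, n)].

Lemma tens_piE s : \pi_tensor s = \sum_(p <- s) tens p.1 p.2.
Proof.
elim: s => [|[m n] s IH]; first by rewrite big_nil.
rewrite big_cons -IH -cat1s; exact: (esym (tens_addE _ _)).
Qed.

Lemma tensDl m m' n : tens (m + m') n = tens m n + tens m' n.
Proof. by apply: etrans (esym (tens_addE _ _)); apply/tens_piP/TensAddl. Qed.

Lemma tensDr m n n' : tens m (n + n') = tens m n + tens m n'.
Proof. by apply: etrans (esym (tens_addE _ _)); apply/tens_piP/TensAddr. Qed.

Lemma tensZ r m n : tens (r *: m) n = tens m (r *: n).
Proof. exact/tens_piP/TensScale. Qed.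

Lemma tens_ind (P : tensor -> Prop) :
  P 0 -> (forall x y, P x -> P y -> P (x + y)) ->
  (forall m n, P (tens m n)) -> forall x, P x.
Proof.
move=> P0 PD Pt x; rewrite -[x]reprK tens_piE.
by elim/big_ind: _ => // i _; exact: Pt.
Qed.

Definition balanced (P : zmodType) (b : M -> N -> P) : Prop :=
  [/\ forall m m' n, b (m + m') n = b m n + b m' n,
      forall m n n', b m (n + n') = b m n + b m n'
    & forall r m n, b (r *: m) n = b m (r *: n)].

(* Meaningful only for balanced b, see tens_liftE. *)
Definition tens_lift (P : zmodType) (b : M -> N -> P) (x : tensor) : P :=
  \sum_(p <- repr x) b p.1 p.2.

Lemma tens_eq_sum (P : zmodType) (b : M -> N -> P) s t : balanced b ->
  tens_eq s t -> \sum_(p <- s) b p.1 p.2 = \sum_(p <- t) b p.1 p.2.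
Proof.
case=> bDl bDr bZ; elim=> //=.
- by move=> ? ? ? _ -> _ ->.
- by move=> ? ? ? ? _ + _; rewrite !big_cat /= => -> ->.
- by move=> ? ?; rewrite !big_cat /= addrC.
- move=> n; rewrite big_seq1 big_nil /=.
  by apply: (@addrI _ (b 0 n)); rewrite -bDl !addr0.
- by move=> m m' n; rewrite big_seq1 !big_cons big_nil addr0 /= bDl.
- by move=> m m' n; rewrite big_seq1 !big_cons big_nil addr0 /= bDr.
- by move=> r m n; rewrite !big_seq1 /= bZ.
Qed.

Lemma tens_liftE (P : zmodType) (b : M -> N -> P) m n : balanced b ->
  tens_lift b (tens m n) = b m n.
Proof.
move=> bb; rewrite /tens_lift (tens_eq_sum bb (tens_repr _)).
by rewrite big_seq1.
Qed.

Lemma tens_liftD (P : zmodType) (b : M -> N -> P) x y : balanced b ->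
  tens_lift b (x + y) = tens_lift b x + tens_lift b y.
Proof.
move=> bb; rewrite /tens_lift -big_cat /=.
exact: (tens_eq_sum bb (tens_repr _)).
Qed.

Lemma tens_lift0 (P : zmodType) (b : M -> N -> P) : balanced b ->
  tens_lift b 0 = 0.
Proof. by move=> bb; apply/(@addrI _ (tens_lift b 0)); rewrite -tens_liftD// !addr0. Qed.

Definition tens_scale (r : R) : tensor -> tensor :=
  tens_lift (fun m n => tens (r *: m) n).

Fact tens_scale_bal r : balanced (fun m n => tens (r *: m) n).
Proof.
split=> [m m' n|m n n'|a m n]; rewrite ?scalerDr ?tensDl ?tensDr //.
by rewrite scalerA mulrC -scalerA tensZ.
Qed.

Lemma tens_scaleE r m n : tens_scale r (tens m n) = tens (r *: m) n.
Proof. exact: (tens_liftE _ _ (tens_scale_bal r)). Qed.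

Fact tens_scaleDr : right_distributive tens_scale +%R.
Proof. by move=> r x y; exact: (tens_liftD _ _ (tens_scale_bal r)). Qed.

Fact tens_scale0 r : tens_scale r 0 = 0.
Proof. exact: (tens_lift0 (tens_scale_bal r)). Qed.

Fact tens_scaleA a b v : tens_scale a (tens_scale b v) = tens_scale (a * b) v.
Proof.
elim/tens_ind: v => [|x y Hx Hy|m n]; rewrite ?tens_scale0 ?tens_scaleDr ?Hx ?Hy //.
by rewrite !tens_scaleE scalerA.
Qed.

Fact tens_scale1 : left_id 1 tens_scale.
Proof.
elim/tens_ind => [|x y Hx Hy|m n]; rewrite ?tens_scale0 ?tens_scaleDr ?Hx ?Hy //.
by rewrite tens_scaleE scale1r.
Qed.

Fact tens_scaleDl v : {morph tens_scale^~ v : a b / a + b}.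
Proof.
move=> a b; elim/tens_ind: v => [|x y Hx Hy|m n].
- by rewrite !tens_scale0 addr0.
- by rewrite !tens_scaleDr Hx Hy addrACA.
- by rewrite !tens_scaleE scalerDl tensDl.
Qed.

HB.instance Definition _ := GRing.Zmodule_isLmodule.Build R tensor
  tens_scaleA tens_scale1 tens_scaleDr tens_scaleDl.

End TensorDef.

Section TensorMap.
Variables (R : comPzRingType) (M M' N N' : lmodType R).
Variables (f : {linear M -> M'}) (g : {linear N -> N'}).

Definition tens_map : tensor M N -> tensor M' N' :=
  tens_lift (fun m n => tens (f m) (g n)).

Fact tens_map_bal : balanced (fun m n => tens (f m) (g n)).
Proof.
by split=> [m m' n|m n n'|r m n]; rewrite ?linearD ?linearZ ?tensDl ?tensDr ?tensZ.
Qed.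

Lemma tens_mapE m n : tens_map (tens m n) = tens (f m) (g n).
Proof. exact: (tens_liftE _ _ tens_map_bal). Qed.

Lemma tens_mapD : {morph tens_map : x y / x + y}.
Proof. by move=> x y; exact: (tens_liftD _ _ tens_map_bal). Qed.

End TensorMap.

Definition flat (R : comPzRingType) (M : lmodType R) : Prop :=
  forall (N N' : lmodType R) (f : {linear N -> N'}),
    injective f -> injective (@tens_map R M M N N' idfun f).

(* An exact sequence R^m -> R^n -> M -> 0. *)
Definition finitely_presented (R : comNzRingType) (M : lmodType R) : Prop :=
  exists (m n : nat) (rel : {linear 'rV[R]_m -> 'rV[R]_n})
         (gen : {linear 'rV[R]_n -> M}),
    (forall x : M, exists u, gen u = x) /\
    (forall u, gen u = 0 <-> exists v, u = rel v).

(* Not the library's algType, which excludes the zero ring. *)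
Record ralgebra (R : comPzRingType) := RAlgebra {
  ralg_ring : pzRingType;
  ralg_map : {rmorphism R -> ralg_ring};
  ralg_central : forall r a, ralg_map r * a = a * ralg_map r
}.

Section RAlgebraModule.
Variables (R : comPzRingType) (A : ralgebra R).

Definition ralg_sort : Type := ralg_ring A.
HB.instance Definition _ := GRing.PzRing.on ralg_sort.

Definition ralg_scale (r : R) (a : ralg_sort) : ralg_sort := ralg_map A r * a.

Fact ralg_scaleA a b v : ralg_scale a (ralg_scale b v) = ralg_scale (a * b) v.
Proof. by rewrite /ralg_scale rmorphM mulrA. Qed.
Fact ralg_scale1 : left_id 1 ralg_scale.
Proof. by move=> v; rewrite /ralg_scale rmorph1 mul1r. Qed.
Fact ralg_scaleDr : right_distributive ralg_scale +%R.
Proof. by move=> r x y; rewrite /ralg_scale mulrDr. Qed.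
Fact ralg_scaleDl v : {morph ralg_scale^~ v : a b / a + b}.
Proof. by move=> a b; rewrite /ralg_scale rmorphD mulrDl. Qed.

HB.instance Definition _ := GRing.Zmodule_isLmodule.Build R ralg_sort
  ralg_scaleA ralg_scale1 ralg_scaleDr ralg_scaleDl.

Lemma ralg_scaleE r (a : ralg_sort) : r *: a = ralg_map A r * a.
Proof. by []. Qed.

Lemma ralg_scaleAl r (a b : ralg_sort) : r *: (a * b) = (r *: a) * b.
Proof. by rewrite !ralg_scaleE mulrA. Qed.

Lemma ralg_scaleAr r (a b : ralg_sort) : r *: (a * b) = a * (r *: b).
Proof. by rewrite !ralg_scaleE !mulrA ralg_central. Qed.

End RAlgebraModule.

Coercion ralg_sort : ralgebra >-> Sortclass.

(* The tensor product of algebras, (s (x) a) (t (x) b) = (s t) (x) (a b). *)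
Section TensorRing.
Variables (R : comPzRingType) (S A : ralgebra R).

Definition tensor_ring : Type := @tensor R S A.
HB.instance Definition _ := GRing.Lmodule.on tensor_ring.

Let T := @tensor R S A.

Definition tens_mulp (s : S) (a : A) : T -> T :=
  tens_lift (fun (t : S) (b : A) => tens (s * t) (a * b) : T).

Definition tens_mul (x y : T) : T := tens_lift (fun s a => tens_mulp s a y) x.

Fact tens_mulp_bal (s : S) (a : A) :
  balanced (fun (t : S) (b : A) => tens (s * t) (a * b) : T).
Proof.
split=> [m m' n|m n n'|r m n]; rewrite ?mulrDr ?tensDl ?tensDr //.
by rewrite -!ralg_scaleAr tensZ.
Qed.

Lemma tens_mulpE s a t b : tens_mulp s a (tens t b) = tens (s * t) (a * b).
Proof. exact: (tens_liftE _ _ (tens_mulp_bal s a)). Qed.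

Lemma tens_mulpD s a x y : tens_mulp s a (x + y) = tens_mulp s a x + tens_mulp s a y.
Proof. exact: (tens_liftD _ _ (tens_mulp_bal s a)). Qed.

Lemma tens_mulp0 s a : tens_mulp s a 0 = 0.
Proof. exact: (tens_lift0 (tens_mulp_bal s a)). Qed.

Fact tens_mul_bal (y : T) : balanced (fun s a => tens_mulp s a y).
Proof.
split=> [s s' a|s a a'|r s a]; elim/tens_ind: y => [|x y Hx Hy|t b];
  rewrite ?tens_mulp0 ?addr0 // ?tens_mulpD ?Hx ?Hy // 1?addrACA // !tens_mulpE.
- by rewrite mulrDl tensDl.
- by rewrite mulrDl tensDr.
- by rewrite -!ralg_scaleAl tensZ.
Qed.

Lemma tens_mulE s a t b : tens_mul (tens s a) (tens t b) = tens (s * t) (a * b).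
Proof. by rewrite [LHS](tens_liftE _ _ (tens_mul_bal _)) tens_mulpE. Qed.

Fact tens_mulDl : left_distributive tens_mul +%R.
Proof. by move=> x y z; exact: (tens_liftD _ _ (tens_mul_bal _)). Qed.

Fact tens_mul0l y : tens_mul 0 y = 0.
Proof. exact: (tens_lift0 (tens_mul_bal _)). Qed.

Fact tens_mulDr : right_distributive tens_mul +%R.
Proof.
move=> x y z; elim/tens_ind: x => [|x x' Hx Hx'|s a].
- by rewrite !tens_mul0l addr0.
- by rewrite !tens_mulDl Hx Hx' addrACA.
- by rewrite /tens_mul !(tens_liftE _ _ (tens_mul_bal _)) tens_mulpD.
Qed.

Fact tens_mul0r y : tens_mul y 0 = 0.
Proof. by apply: (@addrI _ (tens_mul y 0)); rewrite -tens_mulDr !addr0. Qed.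

Fact tens_mulA : associative tens_mul.
Proof.
move=> x y z; elim/tens_ind: x => [|x x' Hx Hx'|s a];
  first by rewrite !tens_mul0l.
  by rewrite !tens_mulDl Hx Hx'.
elim/tens_ind: y => [|y y' Hy Hy'|t b];
  first by rewrite !(tens_mul0l, tens_mul0r).
  by rewrite !(tens_mulDl, tens_mulDr) Hy Hy'.
elim/tens_ind: z => [|z z' Hz Hz'|u c];
  first by rewrite !tens_mul0r.
  by rewrite !tens_mulDr Hz Hz'.
by rewrite !tens_mulE !mulrA.
Qed.

Fact tens_mul1l : left_id (tens (1 : S) (1 : A)) tens_mul.
Proof.
elim/tens_ind => [|x y Hx Hy|t b]; first by rewrite tens_mul0r.
  by rewrite tens_mulDr Hx Hy.
by rewrite tens_mulE !mul1r.
Qed.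

Fact tens_mul1r : right_id (tens (1 : S) (1 : A)) tens_mul.
Proof.
elim/tens_ind => [|x y Hx Hy|t b]; first by rewrite tens_mul0l.
  by rewrite tens_mulDl Hx Hy.
by rewrite tens_mulE !mulr1.
Qed.

HB.instance Definition _ := GRing.Zmodule_isPzRing.Build tensor_ring
  tens_mulA tens_mul1l tens_mul1r tens_mulDl tens_mulDr.

End TensorRing.

Section Spectrum.
Variable R : comNzRingType.

Record Spec := PrimeIdeal {
  spec_mem : {pred R};
  spec_ideal : idealr_closed spec_mem;
  spec_prime : prime_idealr_closed spec_mem
}.

HB.instance Definition _ := gen_eqMixin Spec.
HB.instance Definition _ := gen_choiceMixin Spec.

Definition spec_set (p : Spec) : set R := [set r | r \in spec_mem p].

Definition vanishing (E : set R) : set Spec := [set p | E `<=` spec_set p].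

Definition zariski_open (U : set Spec) : Prop :=
  exists E : set R, U = ~` vanishing E.

Fact zariski_openT : zariski_open setT.
Proof.
exists setT; apply/esym/seteqP; split=> // p _ /(_ 1 I).
by case: (spec_ideal p) => _ /negP.
Qed.

Fact zariski_openI : setI_closed zariski_open.
Proof.
move=> _ _ [E ->] [F ->]; exists [set x | exists e f, [/\ E e, F f & x = e * f]].
rewrite -setCU; congr (~` _); apply/seteqP; split=> p.
  case: (spec_ideal p) => p0 _ pD.
  have pM a u : u \in spec_mem p -> a * u \in spec_mem p.
    by move=> pu; rewrite -[_ * _]addr0; exact: pD.
  case=> Hp _ [e [f [Ee Ff ->]]]; rewrite /spec_set /=; last exact/pM/Hp.
  by rewrite mulrC; exact/pM/Hp.
move=> Hp; apply: contrapT => /not_orP[/existsNP[e /not_implyP[Ee pe]]].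
move=> /existsNP[f /not_implyP[Ff pf]].
have /spec_prime/orP[] : e * f \in spec_mem p by apply: Hp; exists e, f.
- exact: pe.
- exact: pf.
Qed.

Fact zariski_open_bigU (J : Type) (f : J -> set Spec) :
  (forall i, zariski_open (f i)) -> zariski_open (\bigcup_i f i).
Proof.
move=> /choice[E fE]; exists (\bigcup_i E i).
under eq_bigcupr do rewrite fE.
rewrite -setC_bigcap; congr (~` _); apply/seteqP; split=> p Hp.
  by move=> x [i _ Eix]; exact: (Hp i I).
by move=> i _ x Eix; apply: Hp; exists i.
Qed.

HB.instance Definition _ := isOpenTopological.Build Spec
  zariski_openT zariski_openI zariski_open_bigU.

Definition spec_chain (p : Spec) (n : nat) : Prop :=
  exists q : nat -> Spec, q n = p /\
    forall k, (k < n)%N -> spec_set (q k) `<` spec_set (q k.+1).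

Definition has_height (p : Spec) (n : nat) : Prop :=
  spec_chain p n /\ forall m, spec_chain p m -> (m <= n)%N.

End Spectrum.

Section Irreducible.
Variable X : topologicalType.

Definition irreducible_set (Z : set X) : Prop :=
  Z !=set0 /\ forall F G : set X, closed F -> closed G ->
    Z `<=` F `|` G -> Z `<=` F \/ Z `<=` G.

Definition irreducible_component (Z Y : set X) : Prop :=
  [/\ irreducible_set Y, Y `<=` Z
    & forall Y', irreducible_set Y' -> Y `<=` Y' -> Y' `<=` Z -> Y' = Y].

Definition closed_chain (Y : set X) (n : nat) : Prop :=
  exists C : nat -> set X, [/\ C 0%N = Y,
    forall k, (k <= n)%N -> closed (C k) /\ irreducible_set (C k)
  & forall k, (k < n)%N -> C k `<` C k.+1].

Definition has_codim (Y : set X) (n : nat) : Prop :=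
  closed_chain Y n /\ forall m, closed_chain Y m -> (m <= n)%N.

Definition pure_codim (n : nat) (Z : set X) : Prop :=
  forall Y, irreducible_component Z Y -> has_codim Y n.

Definition reduced_weil_divisor (Z : set X) : Prop :=
  closed Z /\
  (Z = set0 \/
   pure_codim 1 Z /\ finite_set [set Y | irreducible_component Z Y]).

End Irreducible.

Section Localization.
Variable R : idomainType.
Implicit Type p : Spec R.

Fact spec0_ideal : idealr_closed (pred1 (0 : R)).
Proof.
split; rewrite ?inE ?eqxx ?oner_eq0 // => a u v; rewrite !inE => /eqP-> /eqP->.
by rewrite mulr0 addr0.
Qed.

Fact spec0_prime : prime_idealr_closed (pred1 (0 : R)).
Proof. by move=> u v; rewrite !inE mulf_eq0. Qed.

Definition spec0 : Spec R := PrimeIdeal spec0_ideal spec0_prime.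

(* The local ring R_p, as a subring of the fraction field. *)
Definition local_set p : set {fraction R} :=
  [set x | exists r s : R, s \notin spec_mem p /\
             x = FracField.tofrac r / FracField.tofrac s].

Definition local_pred p : {pred {fraction R}} := fun x => `[< local_set p x >].

Fact spec_sN0 p (s : R) : s \notin spec_mem p -> FracField.tofrac s != 0.
Proof.
by rewrite tofrac_eq0; apply: contraNneq => ->; case: (spec_ideal p).
Qed.

Fact spec_sM p (s t : R) :
  s \notin spec_mem p -> t \notin spec_mem p -> s * t \notin spec_mem p.
Proof. by move=> ps pt; apply: contra ps => /spec_prime/orP[//|]; rewrite (negPf pt). Qed.

Fact local_tofrac p (r : R) : FracField.tofrac r \in local_pred p.
Proof.
apply/asboolP; exists r, 1; rewrite tofrac1 divr1; split=> //.
by case: (spec_ideal p).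
Qed.

Fact local_subring p : subring_closed (local_pred p).
Proof.
split=> [|x y /asboolP[r [s [ps ->]]] /asboolP[r' [s' [ps' ->]]]
         |x y /asboolP[r [s [ps ->]]] /asboolP[r' [s' [ps' ->]]]].
- by rewrite -tofrac1; exact: local_tofrac.
- apply/asboolP; exists (r * s' - r' * s), (s * s'); split; first exact: spec_sM.
  rewrite -mulNr addf_div ?(spec_sN0 ps) ?(spec_sN0 ps') //.
  by rewrite tofracB !tofracM mulNr.
- apply/asboolP; exists (r * r'), (s * s'); split; first exact: spec_sM.
  by rewrite mulf_div !tofracM.
Qed.

HB.instance Definition _ p :=
  GRing.isSubringClosed.Build {fraction R} (local_pred p) (local_subring p).

Record local_ring p := LocalRing {
  local_val : {fraction R};
  local_valP : local_val \in local_pred p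
}.

HB.instance Definition _ p := [isSub for @local_val p].
HB.instance Definition _ p := [Choice of local_ring p by <:].
HB.instance Definition _ p := [SubChoice_isSubComNzRing of local_ring p by <:].

Definition local_map p (r : R) : local_ring p := LocalRing (local_tofrac p r).

Fact local_map_zmod p : zmod_morphism (@local_map p).
Proof. by move=> r s; apply: val_inj; rewrite rmorphB /= tofracB. Qed.
Fact local_map_monoid p : monoid_morphism (@local_map p).
Proof.
split=> [|r s]; apply: val_inj; first by rewrite rmorph1 /= tofrac1.
by rewrite rmorphM /= tofracM.
Qed.
HB.instance Definition _ p :=
  GRing.isZmodMorphism.Build R (local_ring p) (@local_map p) (local_map_zmod p).
HB.instance Definition _ p :=
  GRing.isMonoidMorphism.Build R (local_ring p) (@local_map p) (local_map_monoid p).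

Definition local_alg p : ralgebra R :=
  @RAlgebra R (local_ring p) (@local_map p) (fun _ _ => mulrC _ _).

Definition frac_alg : ralgebra R :=
  @RAlgebra R {fraction R} (@FracField.tofrac R) (fun _ _ => mulrC _ _).

Definition local_incl p (x : local_alg p) : frac_alg := local_val x.

Fact local_incl_linear p : linear (@local_incl p).
Proof.
move=> r x y; rewrite !ralg_scaleE.
exact: (rmorphD (\val : local_ring p -> {fraction R})).
Qed.
HB.instance Definition _ p :=
  GRing.isLinear.Build R (local_alg p) frac_alg _ (@local_incl p) (@local_incl_linear p).

Definition is_dvr (V : set {fraction R}) : Prop :=
  exists v : {fraction R} -> int,
  [/\ forall x y, x != 0 -> y != 0 -> v (x * y) = v x + v y,
      forall x y, x != 0 -> y != 0 -> x + y != 0 ->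
        Num.min (v x) (v y) <= v (x + y),
      exists x, x != 0 /\ v x = 1
    & V = [set x | x = 0 \/ 0 <= v x]].

Definition krull_domain : Prop :=
  [/\ forall p, has_height p 1 -> is_dvr (local_set p),
      range (@FracField.tofrac R) =
        \bigcap_(p in [set p | has_height p 1]) local_set p
    & forall r : R, r != 0 ->
        finite_set [set p | has_height p 1 /\ r \in spec_mem p]].

End Localization.

Section Blocks.

Definition central_idempotent (B : pzRingType) (e : B) : Prop :=
  e * e = e /\ forall x, e * x = x * e.

Definition block_idempotent (B : pzRingType) (e : B) : Prop :=
  [/\ central_idempotent e, e <> 0
    & forall e1 e2 : B, central_idempotent e1 -> central_idempotent e2 ->
        e1 * e2 = 0 -> e = e1 + e2 -> e1 = 0 \/ e2 = 0].

(* P' <= P when P' is coarser than P. *)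
Definition partition_le (T : Type) (P' P : set (set T)) : Prop :=
  forall X, P' X -> exists Q : set (set T), Q `<=` P /\ X = \bigcup_(Y in Q) Y.

Definition partition_lt (T : Type) (P' P : set (set T)) : Prop :=
  partition_le P' P /\ P' <> P.

Variables (R : idomainType) (A : ralgebra R).

Definition generic_alg : pzRingType := tensor_ring (frac_alg R) A.

Definition localized_alg (p : Spec R) : pzRingType := tensor_ring (local_alg p) A.

Definition loc_to_generic (p : Spec R) : localized_alg p -> generic_alg :=
  tens_map (@local_incl R p) (@idfun A).

(* The block idempotents of A^K index themselves: the set I of the text is
   [set c : generic_alg | block_idempotent c], with c_i = i. *)
Definition Bl (p : Spec R) : set (set generic_alg) :=
  [set I' | [/\ I' `<=` [set c | block_idempotent c], finite_set I'
    & exists b : localized_alg p,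
        block_idempotent b /\ loc_to_generic b = \sum_(c \in I') c]].

Definition BlEx : set (Spec R) :=
  [set p | partition_lt (Bl p) (Bl (spec0 R))].

End Blocks.

(* Main.v *)
(** A finitely presented flat module has a finite dual basis [(b_i, phi_i)].
    Hence an element of [K (x) A] lies in [R_p (x) A] iff its coordinates, which
    are elements of [K], lie in [R_p].  The partition at [p] is trivial iff every
    block idempotent of [K (x) A] lies in [R_p (x) A], and there are finitely
    many of these idempotents, being orthogonal and hence linearly independent.
    In a Krull domain [R_p] is the intersection of the [R_q] over the height-one
    primes [q] contained in [p], and a given element of [K] lies in all but
    finitely many of these.  So the exceptional set is the union of the closed
    sets [V(q)] for finitely many height-one primes [q]. *)
Require Import Defs.
From HB Require Import structures.
From mathcomp Require Import all_boot all_order all_algebra.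
From mathcomp Require Import all_classical topology.

Set Implicit Arguments.
Unset Strict Implicit.
Unset Printing Implicit Defensive.

Import Order.TTheory GRing.Theory Num.Theory.
Local Open Scope classical_set_scope.
Local Open Scope ring_scope.
Local Open Scope quotient_scope.

(** * Closed subsets of the spectrum *)

Section SpectrumTopology.
Variable R : comNzRingType.
Implicit Types (p q : Spec R) (C F Y : set (Spec R)).

Lemma spec_ext p q : spec_set p = spec_set q -> p = q.
Proof.
case: p q => [P iP pP] [Q iQ pQ]; rewrite /spec_set /= => PQ.
have E : P = Q.
  apply/funext => r; have := congr1 (@^~ r) PQ; rewrite /= propeqE => -[rP rQ].
  by apply/idP/idP.
by case: _ / E iQ pQ {PQ} => iQ pQ; congr PrimeIdeal; exact: Prop_irrelevance.
Qed.

Lemma vanishing_closed (E : set R) : closed (vanishing E).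
Proof. by rewrite -openC; exists E. Qed.

Lemma closed_vanishing F : closed F -> exists E, F = vanishing E.
Proof.
by rewrite -openC => -[E /(congr1 setC)]; rewrite !setCK; exists E.
Qed.

Lemma vanishing_specS p q :
  vanishing (spec_set p) `<=` vanishing (spec_set q) <->
  spec_set q `<=` spec_set p.
Proof.
by split=> [/(_ p)|qp P pP]; [apply|exact: subset_trans pP].
Qed.

Lemma vanishing_spec_proper p q :
  vanishing (spec_set p) `<` vanishing (spec_set q) <->
  spec_set q `<` spec_set p.
Proof. by rewrite /proper !vanishing_specS. Qed.

Lemma closed_vanishing_spec F p :
  closed F -> F p -> vanishing (spec_set p) `<=` F.
Proof.
by move=> /closed_vanishing[E ->] Ep q pq; exact: subset_trans pq.
Qed.

Lemma vanishing_irreducible p : irreducible_set (vanishing (spec_set p)).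
Proof.
split=> [|F G cF cG sFG]; first by exists p.
by case: (sFG p) => // ?; [left|right]; exact: closed_vanishing_spec.
Qed.

(** The generic point is the intersection [I] of all primes in [C]. It is prime because [u * v] in
    [I] covers [C] by the zero loci of [u] and [v], so irreducibility puts [C] inside one of
    them. *)
Lemma irreducible_generic_point C : closed C -> irreducible_set C ->
  exists p, C = vanishing (spec_set p).
Proof.
move=> cC [[p0 Cp0] irrC].
pose I : {pred R} := fun r => `[< forall p, C p -> r \in spec_mem p >].
have iI : idealr_closed I.
  split.
  - by apply/asboolP => p _; case: (spec_ideal p).
  - apply/asboolP => /(_ _ Cp0); apply/negP.
    by case: (spec_ideal p0).
  - move=> a u v /asboolP uI /asboolP vI; apply/asboolP => p Cp.
    by case: (spec_ideal p) => _ _; apply; [exact: uI|exact: vI].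
have pI : prime_idealr_closed I.
  move=> u v /asboolP uvI; apply/orP.
  have [|||CF|CG] := irrC (vanishing [set u]) (vanishing [set v]).
  - exact: vanishing_closed.
  - exact: vanishing_closed.
  - by move=> p /uvI/spec_prime/orP[] ?; [left|right] => _ ->.
  - by left; apply/asboolP => p /CF; exact.
  - by right; apply/asboolP => p /CG; exact.
exists (PrimeIdeal iI pI); apply/seteqP; split=> p Cp.
  by move=> r /asboolP; exact.
have [E CE] := closed_vanishing cC.
rewrite CE => r Er; apply: Cp; apply/asboolP => q.
by rewrite CE => /(_ _ Er).
Qed.

(** Passing to zero loci reverses inclusions. A closed chain ascends from its index 0 while a chain
    of primes ascends to its index [n], hence the reindexing by [n - k]. *)
Lemma closed_chain_vanishing p n :
  closed_chain (vanishing (spec_set p)) n <-> spec_chain p n.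
Proof.
split=> [[C [C0 clC ltC]]|[q [qn ltq]]].
  have /choice[q qC] : forall k, exists q, (k <= n)%N ->
      C k = vanishing (spec_set q).
    move=> k; have [kn|kn] := boolP (k <= n)%N; last by exists p.
    have [cCk iCk] := clC _ kn.
    by have [q ?] := irreducible_generic_point cCk iCk; exists q.
  exists (fun k => q (n - k)%N); split=> [|k kn].
    rewrite subnn; apply: spec_ext; apply/seteqP.
    by split; apply/vanishing_specS; rewrite -qC// C0.
  apply/vanishing_spec_proper.
  rewrite -!qC ?leq_subr// [in X in _ `<` X](_ : (n - k)%N = (n - k.+1).+1).
    by apply: ltC; rewrite ltn_subrL (leq_trans _ kn).
  by rewrite -subSn// subSS.
exists (fun k => vanishing (spec_set (q (n - k)%N))); split=> [|k _|k kn].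
- by rewrite subn0 qn.
- by split; [exact: vanishing_closed|exact: vanishing_irreducible].
- apply/vanishing_spec_proper.
  rewrite [in X in _ `<` X](_ : (n - k)%N = (n - k.+1).+1).
    by apply: ltq; rewrite ltn_subrL (leq_trans _ kn).
  by rewrite -subSn// subSS.
Qed.

Lemma has_codim_vanishing p n :
  has_height p n -> has_codim (vanishing (spec_set p)) n.
Proof.
by move=> [chn chm]; split=> [|m]; rewrite closed_chain_vanishing//; exact: chm.
Qed.

End SpectrumTopology.

Lemma irreducible_sub_bigcup (X : topologicalType) (I : choiceType)
    (Q : set I) (V : I -> set X) (Y : set X) :
  finite_set Q -> (forall i, closed (V i)) -> irreducible_set Y ->
  Y `<=` \bigcup_(i in Q) V i -> exists2 i, Q i & Y `<=` V i.
Proof.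
move=> /finite_seqP[s ->] cV [[y Yy] irrY]; elim: s => [|i s IH] sY.
  by have [j /=] := sY _ Yy.
have [|||Yi|Ys] := irrY (V i) (\bigcup_(j in [set` s]) V j).
- exact: cV.
- by apply: closed_bigcup.
- move=> x /sY[j /=]; rewrite inE => /orP[/eqP->|js] Vj; [by left|].
  by right; exists j.
- by exists i; rewrite /= ?mem_head.
- by have [j js Yj] := IH Ys; exists j; rewrite //= inE js orbT.
Qed.

Lemma bigcup_vanishing_weil_divisor (R : comNzRingType) (Q : set (Spec R)) :
  finite_set Q -> Q `<=` [set q | has_height q 1] ->
  reduced_weil_divisor (\bigcup_(q in Q) vanishing (spec_set q)).
Proof.
set Z := (X in reduced_weil_divisor X) => finQ htQ.
have comp Y : irreducible_component Z Y ->
    exists2 q, Q q & Y = vanishing (spec_set q).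
  move=> [irrY YZ maxY].
  have [q Qq Yq] := irreducible_sub_bigcup finQ
    (fun q => @vanishing_closed R (spec_set q)) irrY YZ.
  (* The locus of [q] is an irreducible subset of [Z] containing [Y], so maximality of [Y] forces
     equality. *)
  exists q => //; apply/esym/maxY => //; first exact: vanishing_irreducible.
  by move=> P qP; exists q.
split; first by apply: closed_bigcup => // q _; exact: vanishing_closed.
(* This alternative also covers empty [Q], where there are no components. *)
right; split=> [Y /comp[q Qq ->]|]; first exact/has_codim_vanishing/htQ.
apply: (@sub_finite_set _ _ ((fun q => vanishing (spec_set q)) @` Q)).
  by move=> Y /comp[q Qq ->]; exists q.
exact: finite_image.
Qed.

(** * Localizations of Krull domains *)

Section KrullLocalization.
Variable R : idomainType.
Local Notation K := {fraction R}.
Local Notation tofrac := (@FracField.tofrac R).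
Implicit Types (p q : Spec R) (x : K) (r s : R).

Lemma fraction_numden x : exists r s, s != 0 /\ x = tofrac r / tofrac s.
Proof.
elim/quotW: x => x; exists (frac x).1, (frac x).2.
have d0 := denom_ratioP x; split=> //.
apply/eqP; rewrite piE /= FracField.equivfE /FracField.mulf /FracField.invf.
by rewrite !numden_Ratio ?oner_eq0 ?mulr1 ?mul1r// mulrC.
Qed.

Lemma local_tofracM p s x : local_set p x -> local_set p (tofrac s * x).
Proof.
move=> /asboolP px; apply/asboolP.
exact: (rpredM (local_tofrac p s : _ \in local_pred p) px).
Qed.

Lemma local_set_sub p q : spec_set q `<=` spec_set p ->
  local_set p `<=` local_set q.
Proof.
move=> qp x [r [s [ps ->]]]; exists r, s; split=> //.
by apply: contra ps; exact: qp.
Qed.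

Lemma local_set0 x : local_set (spec0 R) x.
Proof.
by have [r [s [s0 ->]]] := fraction_numden x; exists r, s.
Qed.

(** An element of [q] has positive valuation at [q], so multiplying by a high enough power of it
    makes any valuation nonnegative. *)
Lemma dvr_clear_denominator q s x : is_dvr (local_set q) ->
  s \in spec_mem q -> s != 0 -> exists n, local_set q (tofrac (s ^+ n) * x).
Proof.
move=> [v [vM _ _ Vq]] qs s0.
have [->|x0] := eqVneq x 0; first by exists 0%N; rewrite mulr0 Vq; left.
have s0' : tofrac s != 0 by rewrite tofrac_eq0.
have v1 : v 1 = 0.
  by apply: (@addrI _ (v 1)); rewrite addr0 -vM ?mulr1 ?oner_eq0.
have vs : 0 < v (tofrac s).
  rewrite ltNge; apply/negP => vs.
  have : local_set q (tofrac s)^-1.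
    rewrite Vq; right; rewrite -oppr_le0.
    have := vM _ _ s0' (invr_neq0 s0'); rewrite divff// v1.
    by move=> /eqP; rewrite eq_sym addrC addr_eq0 => /eqP ->; rewrite opprK.
  (* If [1 / s = r / t] with [t] outside [q], then [t = r * s] lies in [q], a contradiction. *)
  move=> [r [t [qt /eqP]]]; rewrite -div1r eqr_div ?(spec_sN0 qt)//.
  rewrite mul1r -tofracM tofrac_eq => /eqP tE; move/negP: qt; apply.
  by case: (spec_ideal q) => q0 _ qD; rewrite tE -[_ * _]addr0 qD.
have vX n : v (tofrac (s ^+ n)) = v (tofrac s) *+ n.
  elim: n => [|n IH]; first by rewrite expr0 tofrac1 v1.
  by rewrite exprS tofracM vM ?IH ?mulrS// tofrac_eq0 expf_neq0.
(* Since [v s] is at least 1, the exponent [|v x|] outweighs any negative value of [v x]. *)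
exists `|v x|%N; rewrite Vq; right.
rewrite vM ?vX ?tofrac_eq0 ?expf_neq0//.
rewrite -lerBlDr sub0r (le_trans (ler_norm _))// normrN -abszE -natz.
by apply: ler_wMn2r; rewrite -gtz0_ge1.
Qed.

(** The product of the individual multipliers works: it avoids the prime [p], and each localization
    is stable under multiplication by [R]. *)
Lemma common_multiplier p x (l : seq (Spec R)) :
  (forall q, q \in l ->
     exists2 s, s \notin spec_mem p & local_set q (tofrac s * x)) ->
  exists2 s, s \notin spec_mem p &
    forall q, q \in l -> local_set q (tofrac s * x).
Proof.
elim: l => [_|q l IH hl]; first by exists 1 => //; case: (spec_ideal p).
have [s ps sx] := hl q (mem_head _ _).
have [|t pt tx] := IH; first by move=> u ul; apply: hl; rewrite inE ul orbT.
exists (s * t) => [|u]; first exact: spec_sM.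
rewrite inE tofracM -mulrA => /orP[/eqP->|/tx]; last exact: local_tofracM.
by rewrite mulrCA; exact: local_tofracM.
Qed.

Hypothesis krullR : krull_domain R.

(** Write [x = a / b]; finitely many height-one [q] contain [b]. If [q] lies in [p], then [x] is
    already in the local ring at [q]; otherwise a power of some element of [q] outside [p] clears
    the denominator there. A common multiplier [s] outside [p] then puts [s * x] in every height-one
    localization, hence in [R]. *)
Lemma krull_local_height1 p x :
  (forall q, has_height q 1 -> spec_set q `<=` spec_set p -> local_set q x) ->
  local_set p x.
Proof.
case: krullR => dvrR capR finR px; have [a [b [b0 xE]]] := fraction_numden x.
have /finite_seqP[l lE] := finR b b0.
have [s ps sx] : exists2 s, s \notin spec_mem p &
    forall q, q \in l -> local_set q (tofrac s * x).
  apply: common_multiplier => q ql.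
  have [hq _] : [set q | has_height q 1 /\ b \in spec_mem q] q by rewrite lE.
  have [/px qx|/existsNP[s /not_implyP[qs /negP ps]]] :=
      pselect (spec_set q `<=` spec_set p).
    exists 1; first by case: (spec_ideal p).
    by rewrite tofrac1 mul1r; exact: qx.
  have s0 : s != 0.
    by apply: contraNneq ps => ->; case: (spec_ideal p).
  have [n snx] := dvr_clear_denominator x (dvrR _ hq) qs s0.
  exists (s ^+ n) => //; elim: n {snx} => [|n IH].
    by rewrite expr0; case: (spec_ideal p).
  by rewrite exprS spec_sM.
have : range tofrac (tofrac s * x).
  (* Primes containing [b] are handled by the choice of [s]; at the others [a / b] is already a
     local fraction. *)
  rewrite capR => q /= hq; have [bq|bq] := boolP (b \in spec_mem q).
    by apply: sx; have : [set` l] q by rewrite -lE.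
  by apply: local_tofracM; exists a, b.
move=> [r _ rE]; exists r, s; split=> //.
by rewrite rE mulrAC divff ?mul1r// (spec_sN0 ps).
Qed.

Lemma krull_finite_poles x :
  finite_set [set q | has_height q 1 /\ ~ local_set q x].
Proof.
case: krullR => _ _ finR; have [a [b [b0 ->]]] := fraction_numden x.
apply: sub_finite_set (finR b b0) => q [hq nq]; split=> //.
by apply: contrapT => /negP bq; apply: nq; exists a, b.
Qed.

End KrullLocalization.
(** * Finitely presented flat modules *)

Section TensorSums.
Variables (R : comPzRingType) (M N : lmodType R).

Lemma tens0l (n : N) : tens (0 : M) n = 0.
Proof. by apply: (@addrI _ (tens 0 n)); rewrite -tensDl !addr0. Qed.

Lemma tens0r (m : M) : tens m (0 : N) = 0.
Proof. by apply: (@addrI _ (tens m 0)); rewrite -tensDr !addr0. Qed.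

Lemma tens_suml I (r : seq I) (F : I -> M) (n : N) :
  tens (\sum_(i <- r) F i) n = \sum_(i <- r) tens (F i) n.
Proof. exact: (big_morph _ (fun x y => tensDl x y n) (tens0l n)). Qed.

Lemma tens_sumr I (r : seq I) (m : M) (F : I -> N) :
  tens m (\sum_(i <- r) F i) = \sum_(i <- r) tens m (F i).
Proof. exact: (big_morph _ (tensDr m) (tens0r m)). Qed.

Lemma tens_lift_sum (P : zmodType) (b : M -> N -> P) I (r : seq I) F :
  balanced b ->
  tens_lift b (\sum_(i <- r) F i) = \sum_(i <- r) tens_lift b (F i).
Proof.
move=> bb.
exact: (big_morph _ (fun x y => tens_liftD x y bb) (tens_lift0 bb)).
Qed.

End TensorSums.

Section LinearImage.
Variables (R : comNzRingType) (P Q : lmodType R) (f : {linear P -> Q}).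

Definition image_pred : {pred Q} := fun y => `[< exists x, f x = y >].

Fact image_submod : submod_closed image_pred.
Proof.
split=> [|a _ _ /asboolP[x <-] /asboolP[y <-]]; apply/asboolP.
  by exists 0; rewrite linear0.
by exists (a *: x + y); rewrite linearP.
Qed.

HB.instance Definition _ :=
  GRing.isSubmodClosed.Build R Q image_pred image_submod.

(** The image is made a module in its own right, so that flatness can be applied to its inclusion
    into [Q]. *)
Record linear_image := LinearImage {
  image_val : Q;
  image_valP : image_val \in image_pred
}.

HB.instance Definition _ := [isSub for image_val].
HB.instance Definition _ := [Choice of linear_image by <:].
HB.instance Definition _ := [SubChoice_isSubLmodule of linear_image by <:].

Definition to_image (x : P) : linear_image :=
  @LinearImage (f x) (asboolT (ex_intro _ x erefl)).

Lemma image_preimage (y : linear_image) : exists x, f x = val y.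
Proof. by case: y => y /= /asboolP. Qed.

End LinearImage.

Section DualBasis.
Variables (R : comNzRingType) (M : lmodType R) (m n : nat).
Variables (rel : {linear 'rV[R]_m -> 'rV[R]_n}).
Variables (gen : {linear 'rV[R]_n -> M}).
Hypothesis gen_surj : forall x : M, exists u, gen u = x.
Hypothesis gen_ker : forall u, gen u = 0 <-> exists v, u = rel v.
Hypothesis flatM : @flat R M.

Local Notation U := (lin1_mx rel).
Local Notation e_ j := (delta_mx 0 j).

(* The transpose of the presentation, whose kernel is the dual of M. *)
Definition rel_dual : {linear 'rV[R]_n -> 'rV[R]_m} := mulmxr U^T.

Lemma rel_dualE w : rel_dual w = w *m U^T. Proof. by []. Qed.

(* The image of M (x) ker rel_dual in M (x) R^n = M^n. *)
Definition syzygies : {pred {ffun 'I_n -> M}} := fun f =>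
  `[< exists2 s : seq (M * 'rV[R]_n), all (fun p => rel_dual p.2 == 0) s &
        forall j, f j = \sum_(p <- s) p.2 0 j *: p.1 >].

Fact syzygies_zmod : zmod_closed syzygies.
Proof.
split=> [|f g /asboolP[s Hs fE] /asboolP[t Ht gE]]; apply/asboolP.
  by exists [::] => // j; rewrite big_nil ffunE.
exists (s ++ [seq (- p.1, p.2) | p <- t]) => [|j].
  by rewrite all_cat Hs all_map.
rewrite !ffunE fE gE big_cat big_map; congr (_ + _).
by rewrite -sumrN; apply: eq_bigr => p _; rewrite scalerN.
Qed.

HB.instance Definition _ :=
  GRing.isZmodClosed.Build {ffun 'I_n -> M} syzygies syzygies_zmod.

Local Notation V := {ideal_quot syzygies}.

(** The pure tensor of [a] and [w], with M (x) R^n identified with M^n. *)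
Definition scaled (a : M) (w : 'rV[R]_n) : {ffun 'I_n -> M} :=
  [ffun j => w 0 j *: a].

(** This lets M (x) im [rel_dual] map to the quotient [V]: the choice of a preimage under [rel_dual]
    does not matter there. *)
Lemma scaled_eq_mod (a : M) w w' : rel_dual w = rel_dual w' ->
  \pi_V (scaled a w) = \pi_V (scaled a w').
Proof.
move=> ww'; apply/eqP; rewrite -Quotient.idealrBE; apply/asboolP.
exists [:: (a, w - w')] => [|j].
  by rewrite /= andbT mulmxBl subr_eq0; apply/eqP.
by rewrite !ffunE big_seq1 /= !mxE scalerBl.
Qed.

(** An instance of the equational criterion for flatness. The element [t] of M (x) im [rel_dual]
    dies in M (x) R^m because the generators satisfy the relations. By flatness it is already zero,
    and so is its image in [V], which is the class of the tuple of generators. *)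
Lemma flat_syzygies : [ffun j => gen (e_ j)] \in syzygies.
Proof.
have [pre preE] := choice (@image_preimage _ _ _ rel_dual).
pose b (a : M) (y : linear_image rel_dual) : V := \pi_V (scaled a (pre y)).
have bb : balanced b.
  split=> [a a' y|a y y'|r a y]; rewrite /b.
  - rewrite -pi_addr; congr (\pi_V _).
    by apply/ffunP => j; rewrite !ffunE scalerDr.
  - rewrite -pi_addr.
    rewrite (@scaled_eq_mod _ _ (pre y + pre y')); last first.
      by rewrite [RHS]mulmxDl -!rel_dualE !preE raddfD.
    by congr (\pi_V _); apply/ffunP => j; rewrite !ffunE mxE scalerDl.
  - rewrite [RHS](@scaled_eq_mod _ _ (r *: pre y)); last first.
      by rewrite [RHS]/= -scalemxAl -!rel_dualE !preE linearZ.
    congr (\pi_V _).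
    by apply/ffunP => j; rewrite !ffunE mxE scalerA mulrC.
pose t := \sum_j tens (gen (e_ j)) (to_image rel_dual (e_ j)).
have t0 : t = 0.
  pose f : {linear linear_image rel_dual -> 'rV[R]_m} := \val.
  apply: (flatM (val_inj : injective f)).
  rewrite [RHS]tens_lift0; last exact: tens_map_bal.
  rewrite [LHS]tens_lift_sum; last exact: tens_map_bal.
  under eq_bigr => j _.
    rewrite tens_liftE; last exact: tens_map_bal.
    rewrite [f _](_ : _ = \sum_i U i j *: e_ i); last first.
      rewrite [LHS]row_sum_delta; apply: eq_bigr => i _; congr (_ *: _).
      by rewrite /= -rowE !mxE.
    rewrite tens_sumr; under eq_bigr do rewrite -tensZ.
    over.
  (* Collecting the coefficient of the [i]-th basis vector of R^m gives the sum of the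
     [U i j *: gen (e_ j)], that is [gen (rel (e_ i)) = 0]. *)
  rewrite exchange_big big1 //= => i _; rewrite -tens_suml.
  under eq_bigr do rewrite -linearZ.
  rewrite -linear_sum (_ : \sum_j _ = rel (e_ i)).
    by rewrite (_ : gen _ = 0) ?tens0l//; apply/gen_ker; exists (e_ i).
  rewrite -mul_rV_lin1 -rowE [RHS]row_sum_delta.
  by apply: eq_bigr => j _; rewrite !mxE.
have := congr1 (tens_lift b) t0.
rewrite tens_lift0// tens_lift_sum//.
under eq_bigr => j _ do rewrite tens_liftE// /b (@scaled_eq_mod _ _ (e_ j)) ?preE//.
rewrite -raddf_sum -[RHS](raddf0 \pi_V) => /eqP; rewrite -Quotient.idealrBE subr0.
rewrite (_ : \sum_i _ = [ffun j => gen (e_ j)])//.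
apply/ffunP => i; rewrite sum_ffunE ffunE (bigD1 i)//= big1 => [|j ji].
  by rewrite ffunE mxE !eqxx scale1r addr0.
by rewrite ffunE mxE eqxx eq_sym (negPf ji) scale0r.
Qed.

(** By [flat_syzygies], the generators are combinations of elements of M with coefficient vectors
    [w i] that annihilate the relations. Pairing with [w i] therefore descends from R^n to a
    functional on M, and these functionals are dual to those elements. *)
Lemma presented_dual_basis : exists k (b : 'I_k -> M) (phi : 'I_k -> M -> R),
  (forall i, scalar (phi i)) /\ forall x, x = \sum_i phi i x *: b i.
Proof.
have /asboolP[s Hs sE] := flat_syzygies.
have [pre preE] := choice gen_surj.
pose w (i : 'I_(size s)) := (tnth (in_tuple s) i).2.
have wK i : U *m (w i)^T = 0.
  have /eqP := allP Hs _ (mem_tnth i (in_tuple s)).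
  by rewrite /rel_dual /= => /(congr1 trmx); rewrite trmx_mul trmxK trmx0.
exists (size s), (fun i => (tnth (in_tuple s) i).1).
exists (fun i x => (pre x *m (w i)^T) 0 0); split=> [i r x y|x].
  (* The section [pre] is linear only up to relations, and pairing with [w i] kills these. *)
  have /gen_ker[v vE] : gen (pre (r *: x + y) - (r *: pre x + pre y)) = 0.
    by rewrite linearB linearP !preE subrr.
  have : (pre (r *: x + y) - (r *: pre x + pre y)) *m (w i)^T = 0.
    by rewrite vE -mul_rV_lin1 -mulmxA wK mulmx0.
  rewrite mulmxBl mulmxDl -scalemxAl => /eqP; rewrite subr_eq0 => /eqP->.
  by rewrite !mxE.
rewrite -[LHS]preE [pre x in LHS]row_sum_delta linear_sum.
under eq_bigr => j _.
  rewrite linearZ /= (_ : gen _ = \sum_(p <- s) p.2 0 j *: p.1); last first.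
    by rewrite -sE ffunE.
  rewrite big_tnth scaler_sumr.
  over.
rewrite exchange_big; apply: eq_bigr => i _ /=.
rewrite mxE scaler_suml; apply: eq_bigr => j _.
by rewrite scalerA !mxE.
Qed.

End DualBasis.

Lemma flat_dual_basis (R : comNzRingType) (M : lmodType R) :
  finitely_presented M -> @flat R M ->
  exists k (b : 'I_k -> M) (phi : 'I_k -> M -> R),
  (forall i, scalar (phi i)) /\ forall x, x = \sum_i phi i x *: b i.
Proof.
move=> [m [n [rel [gen [gen_surj gen_ker]]]]] flatM.
exact: (presented_dual_basis gen_surj gen_ker flatM).
Qed.

(** * Block idempotents *)

Section BlockIdempotents.
Variable B : pzRingType.
Implicit Types (c e s : B) (X : set B).

Lemma central_idempotentM e s : central_idempotent e -> central_idempotent s ->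
  central_idempotent (e * s).
Proof.
move=> [ee ce] [ss cs]; split=> [|x].
  by rewrite mulrA -(mulrA e) cs mulrA ee -mulrA ss.
by rewrite -mulrA cs mulrA ce mulrA.
Qed.

(** Primitivity of [s] is applied to the orthogonal decomposition [s = e + (s - e)]. *)
Lemma block_absorb s e : block_idempotent s -> central_idempotent e ->
  e <> 0 -> e * s = e -> s = e.
Proof.
move=> [[ss cs] _ prims] [ee ce] e0 es.
have se : s * e = e by rewrite cs.
have [||||//|/eqP] := prims e (s - e); last by rewrite subr_eq0 => /eqP.
- by [].
- split=> [|x]; last by rewrite mulrBl mulrBr cs ce.
  by rewrite mulrBl !mulrBr ss se es ee subrr subr0.
- by rewrite mulrBr es ee subrr.
- by rewrite addrC subrK.
Qed.

(** The product is a central idempotent absorbed by both blocks; were it nonzero, both would equal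
    it. *)
Lemma block_orthogonal c s : block_idempotent c -> block_idempotent s ->
  c <> s -> c * s = 0.
Proof.
move=> bc bs cs; apply: contrapT => cs0.
have [[[cc cC] _ _] [[ss sC] _ _]] := (bc, bs).
have ics : central_idempotent (c * s) by apply: central_idempotentM.
apply: cs; apply: etrans (esym (block_absorb bs ics cs0 _)).
  by apply: block_absorb => //; rewrite -mulrA sC mulrA cc.
by rewrite -mulrA ss.
Qed.

Lemma block_mul_sum0 c X : finite_set X ->
  X `<=` [set e | block_idempotent e] -> block_idempotent c -> ~ X c ->
  c * (\sum_(e \in X) e) = 0.
Proof.
move=> finX bX bc Xc; rewrite fsbig_finite// mulr_sumr big_seq big1// => e.
rewrite in_fset_set// inE => Xe; apply: block_orthogonal => //; first exact: bX.
by move=> ce; apply: Xc; rewrite ce.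
Qed.

Lemma block_mul_sum c X : finite_set X ->
  X `<=` [set e | block_idempotent e] -> X c -> c * (\sum_(e \in X) e) = c.
Proof.
move=> finX bX Xc; have bc := bX _ Xc; have [[cc _] _ _] := bc.
rewrite (fsbigD1 c)//= mulrDr cc block_mul_sum0 ?addr0//.
- exact: finite_setD.
- by move=> e [/bX].
- by move=> [_]; apply.
Qed.

(** Multiplying the sum by another member [e] of [X] would give [e = e * c = 0]. *)
Lemma block_sum_singleton X c : finite_set X ->
  X `<=` [set e | block_idempotent e] -> X c -> \sum_(e \in X) e = c ->
  X = [set c].
Proof.
move=> finX bX Xc sX; apply/seteqP; split=> [e Xe|_ ->//].
apply: contrapT => ec; have [_ + _] := bX _ Xe; apply.
rewrite -(block_mul_sum finX bX Xe) sX; apply: block_orthogonal => //; exact: bX.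
Qed.

End BlockIdempotents.

(** * Coordinates on the localizations of a projective algebra *)

Section TensorRingTheory.
Variables (R : comPzRingType) (S A : ralgebra R).
Local Notation T := (tensor_ring S A).

Lemma tensor_ring_ind (P : T -> Prop) :
  P 0 -> (forall x y, P x -> P y -> P (x + y)) ->
  (forall s a, P (tens s a)) -> forall x, P x.
Proof. exact: tens_ind. Qed.

Lemma tens_ringM s a t c :
  (tens s a : T) * (tens t c : T) = tens (s * t) (a * c).
Proof. exact: tens_mulE. Qed.

Lemma tens_ring1 : tens (1 : S) (1 : A) = 1 :> T.
Proof. by []. Qed.

Lemma tens_left_central (s : S) (x : T) :
  commutative (@GRing.mul (ralg_ring S)) ->
  (tens s (1 : A) : T) * x = x * (tens s (1 : A) : T).
Proof.
move=> mulSC; elim/tensor_ring_ind: x => [|x y Hx Hy|t a].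
- by rewrite mulr0 mul0r.
- by rewrite mulrDl mulrDr Hx Hy.
- by rewrite !tens_ringM mul1r mulr1; congr tens; exact: mulSC.
Qed.

End TensorRingTheory.

Section Coordinates.
Variables (R : idomainType) (A : ralgebra R) (n : nat).
Variables (b : 'I_n -> A) (phi : 'I_n -> A -> R).
Hypothesis phi_scalar : forall i, scalar (phi i).
Hypothesis phi_basis : forall x, x = \sum_i phi i x *: b i.

HB.instance Definition _ i :=
  GRing.isLinear.Build R A R *%R (phi i) (phi_scalar i).

Section Coord.
Variable S : ralgebra R.

(** The base change of the functional [phi i] to [S]. *)
Definition coord (i : 'I_n) : tensor_ring S A -> S :=
  tens_lift (fun (s : S) a => phi i a *: s).

Fact coord_balanced i : balanced (fun (s : S) (a : A) => phi i a *: s).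
Proof.
split=> [s s' a|s a a'|r s a]; first by rewrite scalerDr.
  by rewrite linearD scalerDl.
by rewrite scalerA mulrC [phi i _ in RHS]linearZ.
Qed.

Lemma coord_tens i s a : coord i (tens s a) = phi i a *: s.
Proof. exact: (tens_liftE _ _ (coord_balanced i)). Qed.

Lemma coordD i : {morph coord i : x y / x + y}.
Proof. by move=> x y; exact: (tens_liftD _ _ (coord_balanced i)). Qed.

Lemma coord0 i : coord i 0 = 0.
Proof. exact: (tens_lift0 (coord_balanced i)). Qed.

Lemma coord_sum i I (r : seq I) F :
  coord i (\sum_(j <- r) F j) = \sum_(j <- r) coord i (F j).
Proof. exact: (big_morph _ (coordD i) (coord0 i)). Qed.

Lemma coord_expand (x : tensor_ring S A) : x = \sum_i tens (coord i x) (b i).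
Proof.
elim/tensor_ring_ind: x => [|x y Hx Hy|s a].
- by rewrite big1// => i _; rewrite coord0 tens0l.
- rewrite {1}Hx {1}Hy -[LHS]big_split; apply: eq_bigr => i _ /=.
  by rewrite coordD tensDl.
- rewrite {1}[a]phi_basis tens_sumr; apply: eq_bigr => i _.
  by rewrite coord_tens tensZ.
Qed.

Lemma coord_eq0 (x : tensor_ring S A) : (forall i, coord i x = 0) -> x = 0.
Proof.
by move=> x0; rewrite [x]coord_expand big1// => i _; rewrite x0 tens0l.
Qed.

Lemma coordMl i s (x : tensor_ring S A) :
  coord i ((tens s (1 : A) : tensor_ring S A) * x) = s * coord i x.
Proof.
elim/tensor_ring_ind: x => [|x y Hx Hy|t a].
- by rewrite mulr0 coord0 mulr0.
- by rewrite mulrDr !coordD Hx Hy mulrDr.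
- by rewrite tens_ringM !coord_tens mul1r ralg_scaleAr.
Qed.

End Coord.

Local Notation AK := (generic_alg A).
Local Notation "'f_ p" := (@loc_to_generic R A p) (at level 8, p at level 2).

Lemma loc_to_generic_tens p s a :
  'f_p (tens s a) = tens (local_incl s) a.
Proof. exact: tens_mapE. Qed.

Lemma loc_to_genericD p : {morph 'f_p : x y / x + y}.
Proof. exact: tens_mapD. Qed.

Lemma loc_to_generic0 p : 'f_p 0 = 0.
Proof. by apply: (@addrI _ ('f_p 0)); rewrite -loc_to_genericD !addr0. Qed.

Lemma loc_to_genericM p : {morph 'f_p : x y / x * y}.
Proof.
move=> x y; elim/tensor_ring_ind: x => [|x x' Hx Hx'|s a].
- by rewrite mul0r loc_to_generic0 mul0r.
- by rewrite mulrDl !loc_to_genericD Hx Hx' mulrDl.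
elim/tensor_ring_ind: y => [|y y' Hy Hy'|t c].
- by rewrite mulr0 loc_to_generic0 mulr0.
- by rewrite mulrDr !loc_to_genericD Hy Hy' mulrDr.
- by rewrite tens_ringM !loc_to_generic_tens [RHS]tens_ringM.
Qed.

Lemma coord_loc_to_generic p i x : coord i ('f_p x) = local_incl (coord i x).
Proof.
elim/tensor_ring_ind: x => [|x y Hx Hy|s a].
- by rewrite loc_to_generic0 !coord0 linear0.
- by rewrite loc_to_genericD !coordD Hx Hy linearD.
- by rewrite loc_to_generic_tens !coord_tens linearZ.
Qed.

Lemma loc_to_generic_inj p : injective 'f_p.
Proof.
move=> x y xy; rewrite [x]coord_expand [y]coord_expand; apply: eq_bigr => i _.
congr tens; apply: val_inj.
by have := congr1 (coord i) xy; rewrite !coord_loc_to_generic.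
Qed.

Lemma loc_to_generic_imageP p (x : AK) :
  (exists y, 'f_p y = x) <-> forall i, local_set p (coord i x).
Proof.
split=> [[y <-] i|px].
  by rewrite coord_loc_to_generic; exact/asboolP/local_valP.
exists (\sum_i tens (LocalRing (asboolT (px i)) : local_alg p) (b i)).
rewrite [RHS]coord_expand.
rewrite (big_morph _ (@loc_to_genericD p) (loc_to_generic0 p)).
by apply: eq_bigr => i _; rewrite loc_to_generic_tens.
Qed.

(** Centrality passes to the generic algebra because that algebra is spanned by products of central
    scalars from K with images of elements of the localized algebra. *)
Lemma central_idempotent_loc p y :
  central_idempotent ('f_p y) <-> central_idempotent y.
Proof.
split=> [[yy cy]|[yy cy]]; split=> [|x].
- by apply: loc_to_generic_inj; rewrite loc_to_genericM.
- by apply: (@loc_to_generic_inj p); rewrite !loc_to_genericM cy.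
- by rewrite -loc_to_genericM yy.
elim/tensor_ring_ind: x => [|u v Hu Hv|k a].
- by rewrite mulr0 mul0r.
- by rewrite mulrDl mulrDr Hu Hv.
have -> : tens k a = (tens k (1 : A) : AK) * 'f_p (tens (1 : local_alg p) a).
  by rewrite loc_to_generic_tens [RHS]tens_ringM mulr1 mul1r.
rewrite mulrA -tens_left_central; last exact: mulrC.
by rewrite -!mulrA -!loc_to_genericM cy.
Qed.

Lemma block_idempotent_loc p y : block_idempotent ('f_p y) -> block_idempotent y.
Proof.
move=> [iy y0 primy]; split; first exact/central_idempotent_loc.
  by move=> y00; apply: y0; rewrite y00 loc_to_generic0.
move=> e1 e2 i1 i2 e12 yE.
have [||||e0|e0] := primy ('f_p e1) ('f_p e2).
- exact/central_idempotent_loc.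
- exact/central_idempotent_loc.
- by rewrite -loc_to_genericM e12 loc_to_generic0.
- by rewrite yE loc_to_genericD.
- by left; apply: (@loc_to_generic_inj p); rewrite loc_to_generic0.
- by right; apply: (@loc_to_generic_inj p); rewrite loc_to_generic0.
Qed.

(** * The block partition at a prime *)

Local Notation blocks := [set c : AK | block_idempotent c].

(** Preimages of generic blocks are blocks of the localized algebra. A local block whose image is
    the sum over [X] absorbs the preimage of any [c] in [X], hence equals it, so [X] is a
    singleton. *)
Lemma Bl_trivial p : (forall c : AK, block_idempotent c -> exists y, 'f_p y = c) ->
  @Bl R A p = [set [set c] | c in blocks].
Proof.
move=> im; apply/seteqP; split=> [X [bX finX [y [by_ yX]]]|_ [c bc <-]].
  have [c Xc] : X !=set0.
    apply/set0P/eqP => X0; have [_ + _] := by_; apply.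
    by apply: (@loc_to_generic_inj p); rewrite yX X0 fsbig_set0 loc_to_generic0.
  exists c; first exact: bX.
  have [z zc] := im _ (bX _ Xc).
  have bz : block_idempotent z by apply: block_idempotent_loc; rewrite zc; exact: bX.
  apply/esym/block_sum_singleton => //; rewrite -yX -zc; congr ('f_p _).
  have [iz z0 _] := bz; apply: block_absorb => //.
  by apply: (@loc_to_generic_inj p); rewrite loc_to_genericM yX zc block_mul_sum.
split=> [_ ->//|//|].
have [y yc] := im _ bc; exists y; split; last by rewrite fsbig_set1.
by apply: block_idempotent_loc; rewrite yc.
Qed.

Lemma BlExP p : BlEx A p <->
  exists2 c : AK, block_idempotent c & exists i, ~ local_set p (coord i c).
Proof.
have Bl0 : @Bl R A (spec0 R) = [set [set c] | c in blocks].
  by apply: Bl_trivial => c _; apply/loc_to_generic_imageP => i; exact: local_set0.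
split=> [[_ neqBl]|[c bc [i pci]]].
  apply: contrapT => noc; apply: neqBl; rewrite Bl0; apply: Bl_trivial => c bc.
  apply/loc_to_generic_imageP => i; apply: contrapT => pci.
  by apply: noc; exists c => //; exists i.
(* Being coarser is automatic, as any set of blocks is a union of singletons; only the inequality of
   partitions uses [c]. *)
split=> [X [bX _ _]|eqBl].
  exists [set [set e] | e in X]; split.
    by rewrite Bl0 => _ [e Xe <-]; exists e => //; exact: bX.
  apply/seteqP; split=> [e Xe|e [_ [e' Xe' <-] ->//]].
  by exists [set e] => //; exists e.
have : @Bl R A p [set c] by rewrite eqBl Bl0; exists c.
move=> [_ _ [y [_ yc]]]; apply: pci; move: i.
by apply/loc_to_generic_imageP; exists y; rewrite yc fsbig_set1.
Qed.

(* Pairwise orthogonal nonzero idempotents are linearly independent over K. *)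
Lemma finite_blocks : finite_set blocks.
Proof.
apply: contrapT => /(infinite_set_fset n.+1)[F Fb]; apply/negP; rewrite -leqNgt.
set s := finmap.enum_fset F.
pose C : 'M[{fraction R}]_(size s, n) :=
  \matrix_(i, k) coord k (tnth (in_tuple s) i).
(* The rows of [C] are the coordinates of more than [n] blocks; their independence would bound the
   number of blocks by [n]. *)
suff /eqP <- : row_free C by exact: rank_leq_col.
apply: inj_row_free => u uC.
pose t i : AK := tnth (in_tuple s) i.
have bt i : block_idempotent (t i) by apply: Fb; exact: mem_tnth.
pose z : AK := \sum_i (tens (u 0 i : frac_alg R) (1 : A) : AK) * t i.
have z0 : z = 0.
  apply: coord_eq0 => k; rewrite coord_sum.
  have := congr1 (fun M : 'rV_n => M 0 k) uC; rewrite !mxE => {2}<-.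
  by apply: eq_bigr => i _; rewrite coordMl mxE.
apply/rowP => j; rewrite mxE; apply: contrapT => /eqP uj.
have [[tt _] tj0 _] := bt j; apply: tj0.
have : z * t j = 0 by rewrite z0 mul0r.
(* Orthogonality leaves only the [j]-th term of [z * t j]; inverting the scalar [u 0 j] then gives
   [t j = 0]. *)
rewrite mulr_suml (bigD1 j)//= big1 ?addr0 => [|i ij]; last first.
  rewrite -mulrA (block_orthogonal (bt i) (bt j)) ?mulr0// /t.
  rewrite !(tnth_nth (0 : AK)) => /eqP.
  rewrite nth_uniq ?finmap.fset_uniq// => /eqP/val_inj/eqP.
  by rewrite (negPf ij).
rewrite -mulrA tt => /(congr1 (GRing.mul (tens ((u 0 j)^-1 : frac_alg R) (1 : A) : AK))).
by rewrite mulr0 mulrA tens_ringM mulr1 [(u 0 j)^-1 * _](mulVf uj) tens_ring1 mul1r.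
Qed.

End Coordinates.

(** * The block-exceptional set *)

Theorem theorem1p3 (R : idomainType) (A : ralgebra R) :
  krull_domain R ->
  @finitely_presented R A ->
  @flat R A ->
  reduced_weil_divisor (BlEx A).
Proof.
move=> krullR fpA flatA.
have [n [b [phi [phi_scalar phi_basis]]]] := flat_dual_basis fpA flatA.
pose coef (c : generic_alg A) i : {fraction R} := coord phi i c.
(* [Q] collects the height-one poles of all coordinates of all blocks. *)
pose Q := \bigcup_(c in [set c : generic_alg A | block_idempotent c])
  \bigcup_(i in [set: 'I_n])
    [set q | has_height q 1 /\ ~ local_set q (coef c i)].
suff -> : BlEx A = \bigcup_(q in Q) vanishing (spec_set q).
  apply: bigcup_vanishing_weil_divisor; last by move=> q [c _ [i _ []]].
  apply: bigcup_finite; first exact: (finite_blocks phi_scalar phi_basis).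
  move=> c _; apply: bigcup_finite => [|i _]; first exact: finite_finset.
  exact: krull_finite_poles.
(* A coordinate outside the local ring at [p] has a pole at some height-one prime inside [p];
   conversely a pole at [q] persists at every prime containing [q]. *)
apply/seteqP; split=> [p /(BlExP phi_scalar phi_basis)[c bc [i pc]]|].
  apply: contrapT => nQ; apply: pc; apply: krull_local_height1 => // q hq qp.
  apply: contrapT => qc; apply: nQ; exists q => //.
  by exists c => //; exists i.
move=> p [q [c bc [i _ [_ qc]]] qp].
apply/(BlExP phi_scalar phi_basis); exists c => //; exists i => pc.
by apply: qc; exact: local_set_sub pc.
Qed.
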